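(* Let $X$ be an infinite Hausdorff space and let $p\in X_\Theta$, i.e. $p=f(X)$ for some continuous selection $f$ for $\mathscr{F}(X)$. Then $p$ is a butterfly point of $X$ if and only if $p$ is the limit of a sequence of points of $X\setminus\{p\}$. Moreover, if $p\in X_\Theta$ is a butterfly point and $X$ is totally disconnected at $p$, then $p$ is also a cut point of $X$.
   Context: All spaces are infinite Hausdorff topological spaces. $\mathscr{F}(X)$ is the set of all nonempty closed subsets of $X$, endowed with the Vietoris topology $\tau_V$, which is generated by the sets $\langle\mathscr{V}\rangle=\{S\in\mathscr{F}(X): S\subset\bigcup\mathscr{V}$ and $S\cap V\neq\varnothing$ for every $V\in\mathscr{V}\}$, where $\mathscr{V}$ runs over the finite families of open subsets of $X$. A selection for $\mathscr{F}(X)$ is a map $f:\mathscr{F}(X)\to X$ with $f(S)\in S$ for every $S\in\mathscr{F}(X)$; it is continuous if it is continuous with respect to $\tau_V$. $X_\Theta=\{f(X): f \text{ is a continuous selection for } \mathscr{F}(X)\}$. A point $p\in X$ is a butterfly point if $\overline{F\setminus\{p\}}\cap\overline{G\setminus\{p\}}=\{p\}$ for some closed sets $F,G\subset X$. A point $p\in X$ is a cut point of $X$ if $X\setminus\{p\}=U\cup V$ and $\overline{U}\cap\overline{V}=\{p\}$ for some subsets $U,V\subset X$. $X$ is totally disconnected at $p\in X$ if $\{p\}$ is an intersection of clopen subsets of $X$. *)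

(* Defs.v *)
From HB Require Import structures.
From mathcomp Require Import all_boot all_order.
From mathcomp Require Import all_classical all_analysis.

Set Implicit Arguments.
Unset Strict Implicit.
Unset Printing Implicit Defensive.

Local Open Scope classical_set_scope.

Record hyperspace (X : topologicalType) : Type := Hyperspace {
  hyperset :> set X ;
  hyperset_closed : closed hyperset ;
  hyperset_nonempty : hyperset !=set0
}.

HB.instance Definition _ (X : topologicalType) := gen_eqMixin (hyperspace X).
HB.instance Definition _ (X : topologicalType) :=
  gen_choiceMixin (hyperspace X).

Definition vietoris_set (X : topologicalType) (V : set (set X)) :
    set (hyperspace X) :=
  [set S : hyperspace X | S `<=` \bigcup_(U in V) U /\
                          (forall U, V U -> S `&` U !=set0)].

HB.instance Definition _ (X : topologicalType) :=
  @isSubBaseTopological.Build (hyperspace X) (set (set X))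
    [set V : set (set X) | finite_set V /\ V `<=` open]
    (@vietoris_set X).

Definition selection (X : topologicalType) (f : hyperspace X -> X) : Prop :=
  forall S : hyperspace X, hyperset S (f S).

(* The whole space is a point of [hyperspace X] only when [X] is nonempty, hence
   the quantification over the (necessarily unique) point lying above [setT]. *)
Definition X_Theta (X : topologicalType) : set X :=
  [set p | exists f : hyperspace X -> X,
     [/\ selection f, continuous f &
         exists2 S : hyperspace X, S = [set: X] :> set X & f S = p]].
Arguments X_Theta X : clear implicits.

Definition butterfly_point (X : topologicalType) (p : X) : Prop :=
  exists F G : set X, [/\ closed F, closed G &
    closure (F `\ p) `&` closure (G `\ p) = [set p]].

Definition cut_point (X : topologicalType) (p : X) : Prop :=
  exists U V : set X, ~` [set p] = U `|` V /\
    closure U `&` closure V = [set p].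

Definition totally_disconnected_at (X : topologicalType) (p : X) : Prop :=
  exists C : set (set X), C `<=` clopen /\ \bigcap_(K in C) K = [set p].

Definition limit_of_sequence (X : topologicalType) (p : X) : Prop :=
  exists u : nat -> X, (forall n, u n <> p) /\ u @ \oo --> p.

(* Main.v *)
Require Import Defs.
From mathcomp Require Import all_boot all_order.
From mathcomp Require Import all_classical all_analysis.

(** Regard a continuous selection as a function [g] on closed nonempty sets, with
    [g X = p]. Its continuity is used in two ways. If closed sets [H] lie between
    sets [R n] and [Z], and the [R n] eventually catch every point of a dense
    subset of [Z], then the points [g H] converge to [g Z]
    ([selection_squeeze]); and if [g (C u T)] lies in an open set, so does
    [g (C u F)] for some finite [F] approximating [T] ([selection_approx]).

    Butterfly points are limits of sequences. It suffices to find an increasing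
    sequence of closed sets [S n] with [g (S n) <> p] such that the closure [Z]
    of their union satisfies [g Z = p]: then [g (S n)] converges to [p]. Such an
    [escaping_chain] is made of sets [S n] that contain the complement of a
    decreasing sequence of open neighbourhoods [W n] of [p].
    - If [g (~W u {p}) <> p] for arbitrarily small [W]
      ([escaping_chain_moved]), continuity keeps [g (~W u T)] away from [p] for
      every closed [T] in the closure of a small neighbourhood. Take [W n]
      shrinking so fast that this applies at every stage to [T], the closure of
      the intersection of all [W n]. The union of [S n = ~(W n) u T] is [X], and
      [g X = p].
    - If [g (~W u {p}) = p] for all small [W] ([escaping_chain_fixed]), then
      [g (~W u {t}) = t] for all [t] close to [p], because the value has to be
      in [W]. With [t n] taken alternately from the two wings of the butterfly,
      [S n = ~(W n) u {t n}] is increasing when [W (n + 1)] avoids [t n]. The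
      limit of the [t n] exists, being [g Z], and it belongs to both wings, so it
      is [p].
    Conversely the even and the odd terms of an injective sequence converging to
    [p] span the wings of a butterfly ([limit_butterfly]).

    Cut points. If [X] is totally disconnected at [p], each point [g (S n)] of
    the chain is separated from [p] by a clopen set. This gives disjoint clopen
    sets [A j] containing [g (S j)], for a subsequence. In [A j] lies a nonempty
    clopen set [E j] all of whose points [x] are values [g (P j u {x})] for one
    closed [P j] that contains [S j] minus [A j] ([selection_peel]). The sets
    [P j u {x}] tend to [Z] because the [A j] are disjoint, so the [E j] shrink
    to [p] as sets, although nothing bounds the [A j]. Hence the union of the
    odd-indexed [E j] accumulates on its complement only at [p], and it is one
    side of the cut; the other side contains the even-indexed ones. *)

Set Implicit Arguments.
Unset Strict Implicit.
Unset Printing Implicit Defensive.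

Local Open Scope classical_set_scope.

(** * Selections as functions on sets *)

Section SetSelections.
Context {X : topologicalType}.
Implicit Types (S T C R A V G N : set X) (US : set (set X)) (g : set X -> X).

(** The basic Vietoris set of the family [US] inside [G]. Keeping the upper
    bound [G] apart from [US] makes these boxes stable under intersection. *)
Definition vietoris_box G US : set (set X) :=
  [set S | [/\ closed S, S !=set0, S `<=` G &
    forall U, US U -> S `&` U !=set0]].

Definition set_selection g :=
  forall S, closed S -> S !=set0 -> S (g S).

Definition set_continuous g :=
  forall S N, closed S -> S !=set0 -> nbhs (g S) N ->
    exists G US, [/\ open G, finite_set US, US `<=` open,
      vietoris_box G US S & vietoris_box G US `<=` g @^-1` N].

Lemma sub_vietoris_boxI G US G' US' :
  vietoris_box (G `&` G') (US `|` US') `<=`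
  vietoris_box G US `&` vietoris_box G' US'.
Proof.
move=> S [cS S0 SG SU]; split; split=> //.
- by move=> x /SG[].
- by move=> U ?; apply: SU; left.
- by move=> x /SG[].
- by move=> U ?; apply: SU; right.
Qed.

Lemma vietoris_box_seq (s : seq (set (set X))) (S : hyperspace X) :
  {in s, forall V : set (set X),
    [/\ finite_set V, V `<=` open & vietoris_set V S]} ->
  exists G US, [/\ open G, finite_set US, US `<=` open, vietoris_box G US S &
    forall T : hyperspace X, vietoris_box G US T ->
      {in s, forall V : set (set X), vietoris_set V T}].
Proof.
have [cS S0] : closed S /\ S !=set0.
  by split; [exact: hyperset_closed|exact: hyperset_nonempty].
elim: s => [_|V s IH sV].
  by exists setT, set0; split=> //; exact: openT.
have [G [US [oG fU oU [_ _ SG SU] sub]]] : exists G US,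
    [/\ open G, finite_set US, US `<=` open, vietoris_box G US S &
    forall T : hyperspace X, vietoris_box G US T ->
      {in s, forall V : set (set X), vietoris_set V T}].
  by apply: IH => V' V's; apply: sV; rewrite inE V's orbT.
have [fV oV [SV SVU]] := sV V (mem_head _ _).
exists (G `&` \bigcup_(U in V) U), (US `|` V); split.
- by apply: openI => //; exact: bigcup_open.
- by rewrite finite_setU.
- by move=> U [/oU|/oV].
- split=> // [x Sx|U [/SU//|/SVU//]].
  by split; [exact: SG|exact: SV].
- move=> T /sub_vietoris_boxI[TG [_ _ TV TVU]] V'.
  by rewrite inE => /predU1P[->//|]; exact: sub.
Qed.

Lemma vietoris_box_base (S : hyperspace X) (B : set (hyperspace X)) :
  nbhs S B -> exists G US, [/\ open G, finite_set US, US `<=` open,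
    vietoris_box G US S &
    forall T : hyperspace X, vietoris_box G US T -> B T].
Proof.
rewrite nbhsE => -[B' [[J JI <-] [I JI' IS]] sB].
have /JI[/= D Dsub defI] := JI'.
have Dvs (T : hyperspace X) :
    (forall V : set (set X), V \in finmap.enum_fset D -> vietoris_set V T) ->
    I T.
  by move=> h; rewrite -defI => V; exact: h.
have Dv (V : set (set X)) : V \in finmap.enum_fset D -> vietoris_set V S.
  by move=> VD; move: IS; rewrite -defI; apply.
have [V VD|G [US [? ? ? ? sub]]] := @vietoris_box_seq (finmap.enum_fset D) S.
  have /set_mem[] := Dsub V VD.
  by split=> //; exact: Dv.
exists G, US; split=> // T TG.
by apply: sB; exists I => //; apply: Dvs => V; exact: sub.
Qed.

(** Total on [set X], so that the sets fed to a selection can be written down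
    without bundling proofs of closedness and nonemptiness. *)
Definition extend_selection (f : hyperspace X -> X) (p : X) S : X :=
  match pselect (closed S /\ S !=set0) with
  | left h => f (Hyperspace h.1 h.2)
  | right _ => p
  end.

Lemma extend_selectionE f p S (cS : closed S) (S0 : S !=set0) :
  extend_selection f p S = f (Hyperspace cS S0).
Proof.
rewrite /extend_selection; case: pselect => [h|[]//].
by rewrite (Prop_irrelevance h.1 cS) (Prop_irrelevance h.2 S0).
Qed.

Lemma extend_selection_selection f p :
  selection f -> set_selection (extend_selection f p).
Proof.
move=> fS S cS S0; rewrite (extend_selectionE _ _ cS S0).
exact: (fS (Hyperspace cS S0)).
Qed.

Lemma extend_selection_continuous f p :
  continuous f -> set_continuous (extend_selection f p).
Proof.
move=> fC S N cS S0; rewrite (extend_selectionE _ _ cS S0).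
move=> /fC/vietoris_box_base[G [US [? ? ? ? sub]]].
exists G, US; split=> // T TG; have [cT T0 _ _] := TG.
by rewrite /= (extend_selectionE _ _ cT T0); exact: (sub (Hyperspace cT T0)).
Qed.

End SetSelections.

(** * Filters and sequences *)

Lemma filter_finite_bigcap T (I : choiceType) (D : set I) (f : I -> set T)
    (F : set_system T) {FF : Filter F} :
  finite_set D -> (forall i, D i -> F (f i)) -> F (\bigcap_(i in D) f i).
Proof. by move=> /finite_fsetP[E ->] fF; exact: filter_bigI. Qed.

Lemma fast_subsequence (Q : nat -> nat -> Prop) :
  (forall n, \forall k \near \oo, Q n k) ->
  exists phi : nat -> nat, (forall i, i <= phi i) /\
    forall i j, i < j -> Q (phi i) (phi j).
Proof.
move=> Qev; have /choice[h hP] : forall n, exists m,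
    n < m /\ forall k, m <= k -> Q n k.
  move=> n; have [m _ mQ] := Qev n; exists (maxn m n.+1); split.
    by rewrite leq_max ltnSn orbT.
  by move=> k; rewrite geq_max => /andP[/mQ].
pose phi i := iter i h 0.
have phiS i : phi i < phi i.+1 by have [] := hP (phi i).
have phi_lt : {homo phi : i j / i < j}.
  by apply: homo_ltn => // ? ? ?; exact: ltn_trans.
exists phi; split=> [|i j ij]; first by elim=> // i /leq_ltn_trans; apply.
apply: (hP (phi i)).2.
move: ij; rewrite leq_eqVlt => /predU1P[<-//|/phi_lt/ltnW//].
Qed.

Lemma dependent_choice_seq (T : Type) (P : T -> Prop)
    (R : nat -> T -> T -> Prop) (x0 : T) :
  P x0 -> (forall n x, P x -> exists2 y, P y & R n x y) ->
  exists f : nat -> T, (forall n, P (f n)) /\ (forall n, R n (f n) (f n.+1)).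
Proof.
move=> Px0 step.
pose R' (a b : nat * {x | P x}) :=
  b.1 = a.1.+1 /\ R a.1 (sval a.2) (sval b.2).
have [|f [f0 fS]] :=
    @dependent_choice (nat * {x | P x}) R' _ (0, exist P x0 Px0).
  move=> [n [x Px]]; apply: cid; have [y Py Rxy] := step n x Px.
  by exists (n.+1, exist P y Py).
have f1 n : (f n).1 = n by elim: n => [|n IH]; [rewrite f0|rewrite (fS n).1 IH].
exists (fun n => sval (f n).2); split=> n; first exact: svalP.
by have [_] := fS n; rewrite f1.
Qed.

Lemma near_infty_odd (b : bool) (Q : nat -> Prop) :
  (\forall n \near \oo, Q n) -> exists2 n, odd n = b & Q n.
Proof.
move=> [m _ mQ]; exists (m.*2 + b); first by rewrite oddD odd_double oddb.
by apply: mQ => /=; rewrite -addnn -addnA leq_addr.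
Qed.

Lemma nondecreasing_chain (T : Type) (S : nat -> set T) :
  (forall n, S n `<=` S n.+1) -> forall m n, m <= n -> S m `<=` S n.
Proof.
move=> SS m; elim=> [|n IH]; first by rewrite leqn0 => /eqP->.
by rewrite leq_eqVlt => /predU1P[->//|/IH h x /h/SS].
Qed.

(** * Continuity of selections on a Hausdorff space *)

Section HausdorffSelections.
Context {X : topologicalType} (g : set X -> X).
Context (hausX : hausdorff_space X) (gS : set_selection g)
  (gC : set_continuous g).
Implicit Types (S T C R A V G N F Z P : set X) (US : set (set X)).

Lemma finite_closed F : finite_set F -> closed F.
Proof.
have := hausdorff_accessible hausX; rewrite accessible_finite_set_closed.
exact.
Qed.

Lemma point_closed (x : X) : closed [set x].
Proof. by apply: finite_closed; exact: finite_set1. Qed.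

Lemma closed_setU1 C (x : X) : closed C -> closed (C `|` [set x]).
Proof. by move=> cC; apply: closedU => //; exact: point_closed. Qed.

Lemma separated_nbhs (x y : X) : x <> y ->
  exists N, [/\ open N, N x & ~ closure N y].
Proof.
move=> /eqP; move: hausX; rewrite open_hausdorff => + xy => /(_ _ _ xy).
move=> [[N M] /= [/set_mem Nx /set_mem My] [oN oM NM]].
exists N; split=> // /(_ M (open_nbhs_nbhs (conj oM My))).
by rewrite (eqP _ : N `&` M = set0) ?NM//; case.
Qed.

(** Continuity at [C `|` [set y]]: replacing [y] by a closed set of points close
    to [y] moves the selected point little. *)
Lemma selection_setU C y N : closed C -> nbhs (g (C `|` [set y])) N ->
  exists V, [/\ open V, V y & forall T, closed T -> T !=set0 -> T `<=` V ->
    N (g (C `|` T))].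
Proof.
move=> cC /gC[||G [US [oG fUS oUS [_ _ sG hit] sub]]].
- exact: closed_setU1.
- by exists y; right.
have : nbhs y (G `&` \bigcap_(U in [set U | US U /\ U y]) U).
  apply: filterI; first by apply: open_nbhs_nbhs; split=> //; apply: sG; right.
  apply: filter_finite_bigcap => [|U [USU Uy]].
    by apply: sub_finite_set fUS => U [].
  by apply: open_nbhs_nbhs; split=> //; exact: oUS.
rewrite nbhsE => -[V [oV Vy] sV]; exists V; split=> // T cT T0 TV.
apply: sub; split.
- exact: closedU.
- by case: T0 => t; exists t; right.
- by move=> x [Cx|/TV/sV[]//]; apply: sG; left.
- move=> U USU; have [x [[Cx|->] Ux]] := hit U USU.
    by exists x; split=> //; left.
  case: T0 => t Tt; exists t; split; first by right.
  by have [_] := sV t (TV t Tt); apply.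
Qed.

Lemma finite_hitting US V : finite_set US -> V !=set0 ->
  (forall U, US U -> V `&` U !=set0) ->
  exists F, [/\ finite_set F, F !=set0, F `<=` V &
    forall U, US U -> F `&` U !=set0].
Proof.
move=> fUS [v Vv] hit.
have /choice[h hP] : forall U, exists x, US U -> (V `&` U) x.
  move=> U; have [/hit[x]|nU] := pselect (US U); first by exists x.
  by exists v => /nU.
exists ([set v] `|` h @` US); split.
- by rewrite finite_setU; split; [exact: finite_set1|exact: finite_image].
- by exists v; left.
- by move=> _ [->//|[U USU <-]]; exact: (hP U USU).1.
- move=> U USU; exists (h U); split; last exact: (hP U USU).2.
  by right; exists U.
Qed.

(** Finite sets are dense in the hyperspace. As [T] need only lie in the closure
    of [V], what is known of the finite subsets of a neighbourhood [V] of a point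
    passes to the closed subsets of its closure. In [escaping_chain_moved] this
    does the work of regularity at the point. *)
Lemma selection_approx C T V G : closed C -> closed T -> T !=set0 ->
  T `<=` closure V -> open G -> G (g (C `|` T)) ->
  exists F, [/\ finite_set F, F !=set0, F `<=` V & G (g (C `|` F))].
Proof.
move=> cC cT T0 TV oG Gg.
have [||H [US [oH fUS oUS [_ _ sH hit] sub]]] :=
    @gC (C `|` T) G _ _ (open_nbhs_nbhs (conj oG Gg)).
- exact: closedU.
- by case: T0 => t; exists t; right.
have VH t : T t -> V `&` H !=set0.
  move=> Tt; apply: (TV t Tt); apply: open_nbhs_nbhs; split=> //.
  by apply: sH; right.
have [|||F [fF F0 FVH hitF]] :=
    @finite_hitting (US `&` [set U | T `&` U !=set0]) (V `&` H).
- exact: finite_setIl.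
- by case: T0 => t /VH.
- move=> U [USU [t [Tt Ut]]]; rewrite -setIA; apply: (TV t Tt).
  apply: open_nbhs_nbhs; split; last by split=> //; apply: sH; right.
  by apply: openI => //; exact: oUS.
exists F; split=> //; first by move=> x /FVH[].
apply: sub; split.
- by apply: closedU => //; exact: finite_closed.
- by case: F0 => x; exists x; right.
- by move=> x [Cx|/FVH[]//]; apply: sH; left.
- move=> U USU; have [x [[Cx|Tx] Ux]] := hit U USU.
    by exists x; split=> //; left.
  have [|y [Fy Uy]] := hitF U; first by split=> //; exists x.
  by exists y; split=> //; right.
Qed.

(** The sequence [R] tends to [closure D] from below, so every choice of closed
    sets [H] between the two converges to [closure D] in the Vietoris topology. *)
Lemma selection_squeeze (R : nat -> set X) D N : D !=set0 ->
  (forall x, D x -> \forall n \near \oo, R n x) -> nbhs (g (closure D)) N ->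
  \forall n \near \oo, forall H, closed H -> H !=set0 ->
    R n `<=` H -> H `<=` closure D -> N (g H).
Proof.
move=> [d Dd] DR /gC[||G [US [oG fUS oUS [_ _ sG hit] sub]]].
- exact: closed_closure.
- by exists d; exact: subset_closure.
have : \forall n \near \oo, (\bigcap_(U in US) [set n | R n `&` U !=set0]) n.
  apply: filter_finite_bigcap => // U USU.
  have [z [Zz Uz]] := hit U USU.
  have [x [Dx Ux]] := Zz U (open_nbhs_nbhs (conj (oUS U USU) Uz)).
  by near=> n; exists x; split=> //; near: n; exact: DR.
apply: filterS => n Rn H cH H0 RH HZ; apply: sub; split=> //.
  by move=> x /HZ/sG.
by move=> U /Rn[x [/RH ? ?]]; exists x.
Unshelve. all: by end_near. Qed.


(** A point [x <> p] has a neighbourhood that meets only finitely many of the sets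
    [U n], and a finite union of closed sets is closed. *)
Lemma closure_shrinking_union (U : nat -> set X) (p : X) (J : set nat) :
  (forall n, closed (U n)) ->
  (forall N, nbhs p N -> \forall n \near \oo, U n `<=` N) ->
  closure (\bigcup_(n in J) U n) `<=` \bigcup_(n in J) U n `|` [set p].
Proof.
move=> cU Up x clx; apply: contrapT => /not_orP[nUx /eqP/eqP/nesym px].
have [N [oN Np nNx]] := separated_nbhs px.
have [m _ mU] := Up N (open_nbhs_nbhs (conj oN Np)).
have [|y [[n Jn Uny] [nNy nUy]]] :=
    clx (~` closure N `&` ~` (\bigcup_(n in J `&` `I_m) U n)).
  apply: open_nbhs_nbhs; split; last first.
    by split=> // -[n [Jn _] Unx]; apply: nUx; exists n.
  apply: openI; apply: closed_openC; first exact: closed_closure.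
  by apply: closed_bigcup => //; exact: finite_setIr.
have [nm|mn] := ltnP n m; first by apply: nUy; exists n.
by apply: nNy; apply: subset_closure; exact: mU Uny.
Qed.

(** Enlarge [R] by a finite part of [S `&` A] such that the selected point still
    lies in [A], then take the selected point away again and again, as long as
    the point selected next is in [A]. At the last step [P `|` [set x]] selects
    [x] in [A], whereas [P] selects no point of [A]. The set [E] of all [y] in [A]
    selected by [P `|` [set y]] is closed by continuity. It is open because
    a point of [E] is outside [P], hence nearby sets [P `|` [set z]] select
    a point outside [P], which can only be [z]. *)
Lemma selection_peel R A S :
  closed R -> clopen A -> R `<=` ~` A -> closed S -> R `<=` S ->
  S `<=` R `|` A -> S !=set0 -> A (g S) ->
  exists P E, [/\ [/\ closed P, R `<=` P & P `<=` S],
    clopen E, E !=set0, E `<=` A & forall x, E x -> g (P `|` [set x]) = x].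
Proof.
move=> cR [oA cA] RA cS RS SRA S0 AgS.
have defS : S = R `|` (S `&` A).
  apply/seteqP; split=> [x Sx|x [/RS//|[]//]].
  by have [|] := SRA x Sx; [left|right].
have [||||||F [/finite_seqP[s ->] F0 sSA Ags]] :=
    @selection_approx R (S `&` A) (S `&` A) A.
- by [].
- exact: closedI.
- by exists (g S); split=> //; exact: gS.
- exact: subset_closure.
- by [].
- by rewrite [X in A (g X)](_ : _ = S).
have {F0} Rs0 : (R `|` [set` s]) !=set0 by case: F0 => x; exists x; right.
have [P [x [cP RP PS Ax [gx nAP]]]] : exists P x, [/\ closed P, R `<=` P,
    P `<=` S, A x & g (P `|` [set x]) = x /\ (P !=set0 -> ~ A (g P))].
  have [n] := ubnP (size s); elim: n s sSA Ags Rs0 => // n IH s sSA Ags Rs0 sn.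
  have cs : closed (R `|` [set` s]).
    by apply: closedU => //; apply: finite_closed; exact: finite_seq.
  set x := g (R `|` [set` s]) in Ags *.
  have xs : x \in s by have [/RA|] := gS cs Rs0.
  pose s' := [seq y <- s | y != x].
  have s's : [set` s'] `<=` [set` s].
    by move=> y /=; rewrite mem_filter => /andP[].
  have s'n : size s' < n.
    rewrite -ltnS (leq_trans _ sn)// ltnS size_filter.
    rewrite -(count_predC (fun y => y != x)) -addn1 leq_add2l.
    by rewrite -has_count; apply/hasP; exists x => //=; rewrite eqxx.
  have [[P0 AP]|nP] := pselect ((R `|` [set` s']) !=set0 /\
      A (g (R `|` [set` s']))).
    by apply: (IH s') => //; exact: subset_trans sSA.
  exists (R `|` [set` s']), x; split=> //.
  - by apply: closedU => //; apply: finite_closed; exact: finite_seq.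
  - by move=> y [/RS//|/s's/sSA[]].
  - split; last by move=> P0 AP; apply: nP.
    rewrite {2}/x; congr (g _); apply/seteqP; split=> [y [[Ry|/s's]|->]|y].
    + by left.
    + by right.
    + by right.
    + move=> [Ry|ys]; first by left; left.
      have [->|yx] := eqVneq y x; first by right.
      by left; right; rewrite /= mem_filter yx.
pose E := [set y | A y /\ g (P `|` [set y]) = y].
exists P, E; split=> //; last 3 first.
- by exists x.
- by move=> y [].
- by move=> y [].
split.
- rewrite openE => y [Ay gy].
  have nPy : ~ P y.
    move=> Py; apply: nAP; first by exists y.
    suff <- : P `|` [set y] = P by rewrite gy.
    by apply/seteqP; split=> [z [//|->//]|z]; left.
  have [|V [oV Vy sV]] := @selection_setU P y (~` P) cP.
    by rewrite gy; apply: open_nbhs_nbhs; split=> //; exact: closed_openC.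
  have : nbhs y (V `&` A).
    by apply: open_nbhs_nbhs; split=> //; exact: openI.
  apply: filterS => z [Vz Az]; split=> //.
  have [|Pg|//] := gS (closed_setU1 (x := z) cP); first by exists z; right.
  suff : (~` P) (g (P `|` [set z])) by [].
  by apply: sV; [exact: point_closed|exists z|move=> _ ->].
- move=> y Ey; have Ay : A y.
    by apply: cA; apply: closureS Ey => z [].
  split=> //; apply: contrapT => gy.
  have [N [oN Ng nNy]] := separated_nbhs gy.
  have [|V [oV Vy sV]] := @selection_setU P y N cP.
    exact: open_nbhs_nbhs.
  have [|z [[Az gz] [Vz nNz]]] := Ey (V `&` ~` closure N).
    apply: open_nbhs_nbhs; split=> //; apply: openI => //.
    exact/closed_openC/closed_closure.
  apply: nNz; apply: subset_closure; rewrite -gz.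
  by apply: sV; [exact: point_closed|exists z|move=> _ ->].
Qed.

(** * Chains of closed sets escaping from a point *)

(** The sets of [KK] serve as separating neighbourhoods of [p]: open ones for
    the convergence to [p], clopen ones for the cut. The inclusion of
    [~` K n] in [S n.+1] says that adding a point outside [K n] to [S n] does not
    lead out of the union of the chain. *)
Definition escaping_chain (KK : set (set X)) (p : X) (S K : nat -> set X) :=
  [/\ forall n, closed (S n) /\ S n !=set0, forall n, S n `<=` S n.+1,
      forall n, KK (K n) /\ ~ K n (g (S n)), forall n, ~` K n `<=` S n.+1 &
      g (closure (\bigcup_n S n)) = p].

Lemma chain_cofinal (S : nat -> set X) : (forall n, S n `<=` S n.+1) ->
  forall x, (\bigcup_n S n) x -> \forall n \near \oo, S n x.
Proof.
move=> SS x [m _ Sx]; exists m => // n mn.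
exact: nondecreasing_chain mn _ Sx.
Qed.

Section Escape.
Context (p : X) (KK : set (set X)).
Context (KK_open : forall K, KK K -> open K /\ K p)
  (KK_sep : forall x, x <> p -> exists K, KK K /\ ~ closure K x).

(** A set [K] of [KK] whose closure avoids [g (~` W `|` [set p])] separates the
    values [g (~` W `|` T)] from [p] for all small finite [T], hence, by
    approximation, for all closed [T] in the closure of a smaller [W']. As the
    closure of the intersection of the sets [W n] lies in all these closures, it
    is a choice of [T] valid at all stages. *)
Lemma escaping_chain_moved :
  g [set: X] = p ->
  (forall N, nbhs p N ->
    exists W, [/\ open W, W p, W `<=` N & g (~` W `|` [set p]) <> p]) ->
  exists S K : nat -> set X, escaping_chain KK p S K.
Proof.
move=> gT moved.
pose bad (W : set X) := [/\ open W, W p & g (~` W `|` [set p]) <> p].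
pose step (W W' : set X) := exists K, [/\ KK K, W' `<=` W, W' `<=` K &
  forall T, closed T -> T !=set0 -> T `<=` closure W' -> ~ K (g (~` W `|` T))].
have [W0 [oW0 W0p _ gW0]] := moved setT filterT.
have [||W [badW stepW]] := @dependent_choice_seq _ bad (fun=> step) W0.
- by [].
- move=> _ W [oW Wp gW]; have [K [KKK nKg]] := KK_sep gW.
  have [oK Kp] := KK_open KKK; have cW := open_closedC oW.
  have [|V [oV Vp sV]] := @selection_setU (~` W) p (~` closure K) cW.
    apply: open_nbhs_nbhs; split=> //.
    exact/closed_openC/closed_closure.
  have [|W' [oW' W'p sW' gW']] := moved (V `&` (K `&` W)).
    by apply: open_nbhs_nbhs; split=> //; do 2?apply: openI.
  exists W' => //; exists K; split=> //; try by move=> x /sW'[_ []].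
  move=> T cT T0 TW' KgT.
  have [F [fF F0 FV KgF]] := selection_approx cW cT T0 TW' oK KgT.
  have : (~` closure K) (g (~` W `|` F)).
    by apply: sV => //; [exact: finite_closed|move=> x /FV/sW'[]].
  by apply; exact: subset_closure.
have /choice[K KP] := stepW.
pose T := closure (\bigcap_n W n).
have T0 : T !=set0.
  by exists p; apply: subset_closure => n _; have [] := badW n.
have cW n : closed (~` W n) by apply: open_closedC; have [] := badW n.
pose S n := ~` W n `|` T.
exists S, K; split=> [n|n|n|n|].
- split; first by apply: closedU => //; exact: closed_closure.
  by case: T0 => t; exists t; right.
- move=> x [nWx|Tx]; [left|by right].
  by have [_ WW _ _] := KP n; move/WW.
- have [KKK _ _ h] := KP n; split=> //; apply: h => //.
    exact: closed_closure.
  by apply: closureS => x; apply.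
- have [_ _ WK _] := KP n.
  by move=> x nKx; left => /WK.
(* the chain exhausts [X]: a point outside some [W n] is in [S n], any other
   point is in [T] *)
- rewrite -[RHS]gT; congr (g _); apply/seteqP; split=> // x _.
  apply: subset_closure; have [Wx|] := pselect ((\bigcap_n W n) x).
    by exists 0 => //; right; exact: subset_closure.
  by move=> /existsNP[n /not_implyP[_ nWx]]; exists n => //; left.
Qed.

(** A point selected from [~` W `|` [set t]] that lies in [W] is [t], and for
    [t] close to [p] it lies in [W] by continuity at [~` W `|` [set p]]. So the
    points [t n] may be prescribed, and alternating them between the wings forces
    their limit to be [p]. *)
Lemma escaping_chain_fixed (F G : set X) N0 :
  closure (F `\ p) `&` closure (G `\ p) = [set p] -> nbhs p N0 ->
  (forall W, open W -> W p -> W `<=` N0 -> g (~` W `|` [set p]) = p) ->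
  exists S K : nat -> set X, escaping_chain KK p S K.
Proof.
move=> FGp N0p fixed.
have [clF clG] : closure (F `\ p) p /\ closure (G `\ p) p.
  suff : (closure (F `\ p) `&` closure (G `\ p)) p by [].
  by rewrite FGp.
pose A n := if odd n then F `\ p else G `\ p.
pose good (W : set X) := [/\ open W, W p & W `<=` N0].
pose step n (W W' : set X) := exists tK : X * set X,
  [/\ A n tK.1, g (~` W `|` [set tK.1]) = tK.1, KK tK.2, ~ tK.2 tK.1 &
      W' `<=` W `&` tK.2].
have [W0 [oW0 W0p] W0N] : exists2 W, open_nbhs p W & W `<=` N0.
  by move: N0p; rewrite nbhsE.
have [||W [goodW stepW]] := @dependent_choice_seq _ good step W0.
- by [].
- move=> n W [oW Wp WN]; have cW := open_closedC oW.
  have [|V [oV Vp sV]] := @selection_setU (~` W) p W cW.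
    rewrite fixed //; exact: open_nbhs_nbhs.
  have [t [At [Vt Wt]]] : A n `&` (V `&` W) !=set0.
    have VWp : nbhs p (V `&` W).
      by apply: open_nbhs_nbhs; split=> //; exact: openI.
    by rewrite /A; case: ifP => _; [exact: clF|exact: clG].
  have tp : t <> p by move: At; rewrite /A; case: ifP => _ [].
  have [K [KKK nKt]] := KK_sep tp; have [oK Kp] := KK_open KKK.
  exists (W `&` K); first by split=> //; [exact: openI|move=> x [/WN]].
  exists (t, K); split=> //=; last first.
    by move=> Kt; apply: nKt; exact: subset_closure.
  have Wg : W (g (~` W `|` [set t])).
    by apply: sV; [exact: point_closed|exists t|move=> _ ->].
  by have [|nWg|] := gS (closed_setU1 (x := t) cW); [exists t; right|move: Wg|].
have /choice[tK tKP] := stepW.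
pose t n := (tK n).1; pose K n := (tK n).2; pose S n := ~` W n `|` [set t n].
have gSt n : g (S n) = t n by have [] := tKP n.
have cS n : closed (S n).
  by apply: closed_setU1; apply: open_closedC; have [] := goodW n.
have S0 n : S n !=set0 by exists (t n); right.
have WK n : W n.+1 `<=` W n `&` K n by have [] := tKP n.
have nKt n : ~ K n (t n) by have [] := tKP n.
have SS n : S n `<=` S n.+1.
  by move=> x [nWx|->]; left => /WK[]// _; exact: nKt.
exists S, K; split=> // [n|n x nKx|].
- by rewrite gSt; have [] := tKP n.
- by left => /WK[].
set Z := closure _.
have US0 : (\bigcup_n S n) !=set0 by exists (t 0), 0 => //; right.
have gZ b : closure (\bigcup_(n in [set n | odd n = b]) [set t n]) (g Z).
  move=> N gN.
  have near_t : \forall n \near \oo, N (t n).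
    have := selection_squeeze US0 (chain_cofinal SS) gN.
    apply: filterS => n /(_ (S n)); rewrite gSt; apply=> //.
    by move=> x Sx; apply: subset_closure; exists n.
  have [n nb Nt] := near_infty_odd b near_t.
  by exists (t n); split=> //; exists n.
suff : (closure (F `\ p) `&` closure (G `\ p)) (g Z) by rewrite FGp.
have At n : A n (t n) by have [] := tKP n.
split.
- have := gZ true; apply: closureS => _ [n /= nb ->].
  by have := At n; rewrite /A nb.
- have := gZ false; apply: closureS => _ [n /= nb ->].
  by have := At n; rewrite /A nb.
Qed.

Lemma butterfly_escaping_chain : g [set: X] = p -> butterfly_point p ->
  exists S K : nat -> set X, escaping_chain KK p S K.
Proof.
move=> gT [F [G [_ _ FGp]]].
have [moved|] := pselect (forall N, nbhs p N -> exists W,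
    [/\ open W, W p, W `<=` N & g (~` W `|` [set p]) <> p]).
  exact: escaping_chain_moved.
move=> /existsNP[N /not_implyP[Np fixed]].
apply: (escaping_chain_fixed FGp Np) => W oW Wp WN.
by apply: contrapT => gW; apply: fixed; exists W.
Qed.

End Escape.

(** * Limits of sequences and cut points *)

Lemma escaping_chain_cvg KK p (S K : nat -> set X) N :
  (forall K', KK K' -> K' p) -> escaping_chain KK p S K -> nbhs p N ->
  \forall n \near \oo, N (g (S n)).
Proof.
move=> KKp [cS SS KKn KS gZ]; rewrite -{1}gZ => pN.
have S0 : (\bigcup_n S n) !=set0 by have [_ [x Sx]] := cS 0; exists x, 0.
have := selection_squeeze S0 (chain_cofinal SS) pN.
apply: filterS => n /(_ (S n)); have [cSn Sn0] := cS n; apply=> //.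
by move=> x Sx; apply: subset_closure; exists n.
Qed.

Lemma escaping_chain_limit KK p (S K : nat -> set X) :
  (forall K', KK K' -> K' p) -> escaping_chain KK p S K ->
  limit_of_sequence p.
Proof.
move=> KKp ch; exists (fun n => g (S n)); split; last first.
  by move=> N pN; exact: escaping_chain_cvg ch pN.
move=> n gp; have [_ _ /(_ n)[/KKp Kp nK] _ _] := ch.
by apply: nK; rewrite gp.
Qed.

(** Thinning out the chain puts [g (S j)] in [K i] for all [i < j], so the clopen
    sets [A j], the part of [~` K j] inside all earlier [K i], are disjoint and
    contain [g (S j)]. A fixed point of the chain is in at most one of them, so
    the sets [S j `\` A j] still tend to the closure of the chain, whose value is
    [p]. Therefore the clopen subsets of the [A j] obtained by peeling shrink to
    [p]. *)
Lemma escaping_chain_cut p (S K : nat -> set X) :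
  escaping_chain (fun K' => clopen K' /\ K' p) p S K -> cut_point p.
Proof.
move=> ch; have [cS SS KKn KS gZ] := ch.
have near_K n : \forall k \near \oo, K n (g (S k)).
  have [[[oK _] Kp] _] := KKn n.
  by apply: escaping_chain_cvg ch _ => [K' []//|]; exact: open_nbhs_nbhs.
have [phi [phi_ge phiK]] := fast_subsequence near_K.
pose A j := ~` K (phi j) `&` \bigcap_(i in `I_j) K (phi i).
have clA j : clopen (A j).
  apply: clopenI.
    by have [[? _] _] := KKn (phi j); exact: (@clopenC _ _ set0).
  split; last by apply: closed_bigI => i _; have [[[]]] := KKn (phi i).
  rewrite openE => x Kx; apply: filter_finite_bigcap => // i ij.
  have [[[oK _] _] _] := KKn (phi i).
  by apply: open_nbhs_nbhs; split=> //; exact: Kx.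
have A_disj i j x : i < j -> A i x -> ~ A j x.
  by move=> ij [nKx _] [_ /(_ i ij)].
pose R j := S (phi j) `\` A j.
have peel j : exists PE : set X * set X, let P := PE.1 in let E := PE.2 in
    [/\ [/\ closed P, R j `<=` P & P `<=` S (phi j)],
    clopen E, E !=set0, E `<=` A j & forall x, E x -> g (P `|` [set x]) = x].
  have [cSj Sj0] := cS (phi j); have [oA cA] := clA j.
  have [|||||P [E PE]] :=
      @selection_peel (R j) (A j) (S (phi j)) _ (clA j) _ cSj _ _ Sj0.
  - by apply: closedI => //; exact: open_closedC.
  - by move=> x [].
  - by move=> x [].
  - by move=> x Sx; have [|] := pselect (A j x); [right|left].
  - split; first by have [_] := KKn (phi j).
    by move=> i ij; exact: phiK.
  by exists (P, E).
have /choice[PE PEP] := peel.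
pose E j := (PE j).2.
have EA j : E j `<=` A j by have [] := PEP j.
have clE j : clopen (E j) by have [] := PEP j.
have E0 j : E j !=set0 by have [] := PEP j.
set Z := closure _ in gZ.
have SZ n : S n `<=` Z by move=> x Sx; apply: subset_closure; exists n.
have S0 : (\bigcup_n S n) !=set0 by have [_ [x Sx]] := cS 0; exists x, 0.
have RD x : (\bigcup_n S n) x -> \forall j \near \oo, R j x.
  move=> /(chain_cofinal SS)[m _ Sm].
  have : \forall j \near \oo, ~ A j x.
    have [[i Aix]|nA] := pselect (exists i, A i x).
      by exists i.+1 => // j /= ij; exact: A_disj Aix.
    by apply: nearW => j Ajx; apply: nA; exists j.
  move=> nA; near=> j; split; last by near: j.
  apply: Sm => /=; apply: leq_trans (phi_ge j).
  by near: j; exact: nbhs_infty_ge.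
have Ep N : nbhs p N -> \forall j \near \oo, E j `<=` N.
  rewrite -{1}gZ => pN.
  have := selection_squeeze S0 RD pN.
  apply: filterS => j h x Ex; have [[cP RP PS] _ _ _ gx] := PEP j.
  rewrite -(gx x Ex); apply: h.
  - exact: closed_setU1.
  - by exists x; right.
  - by move=> y /RP; left.
  (* [A j] is outside [K (phi j)], hence within the next set of the chain *)
  - move=> y [/PS/SZ//|->]; apply: (SZ (phi j).+1); apply: KS.
    by have [] := EA j x Ex.
have nEp j : ~ E j p.
  by move=> /EA[]; have [[_ Kp] _] := KKn (phi j).
pose UE b := \bigcup_(j in [set j | odd j = b]) E j.
have clUE b : closure (UE b) p.
  move=> N /Ep/(near_infty_odd b)[j jb EN]; have [x Ex] := E0 j.
  by exists x; split; [exists j|exact: EN].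
have UEp b : closure (UE b) `<=` UE b `|` [set p].
  by apply: closure_shrinking_union => // j; have [] := clE j.
have oUE b : open (UE b) by apply: bigcup_open => j _; have [] := clE j.
exists (UE true), (~` [set p] `\` UE true); split.
  apply/seteqP; split=> [x xp|x [[j _ Ejx] xp|[]//]].
    by have [|] := pselect (UE true x); [left|right].
  by apply: (nEp j); rewrite -xp.
apply/seteqP; split=> [x [/UEp[Ux|//] clV]|_ ->].
  have [y [[_ nUy] //]] := clV _ (open_nbhs_nbhs (conj (oUE true) Ux)).
split; first exact: clUE.
apply: closureS (clUE false) => x [j jf Ejx]; split.
  by move=> xp; apply: (nEp j); rewrite -xp.
move=> [i /= it Eix]; have [ij|ji|ij] := ltngtP i j.
- exact: A_disj ij (EA _ _ Eix) (EA _ _ Ejx).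
- exact: A_disj ji (EA _ _ Ejx) (EA _ _ Eix).
- by move: jf; rewrite /= -ij it.
Unshelve. all: by end_near. Qed.

(** For an injective sequence converging to [p], closing the odd and the even
    terms adds only [p] to two disjoint sets. *)
Lemma limit_butterfly (p : X) : limit_of_sequence p -> butterfly_point p.
Proof.
move=> [u [up u_p]].
have near_neq n : \forall k \near \oo, u k <> u n.
  apply: (u_p (~` [set u n])); apply: (open_nbhs_nbhs (A := ~` [set u n])).
  by split; [exact/closed_openC/point_closed|move=> /esym/up].
have [phi [phi_ge phiP]] := fast_subsequence near_neq.
pose U i := [set u (phi i)].
have Up N : nbhs p N -> \forall i \near \oo, U i `<=` N.
  move=> /u_p[m _ mN]; exists m => // i mi _ ->; apply: mN => /=.
  exact: leq_trans mi (phi_ge i).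
pose F b := \bigcup_(i in [set i | odd i = b]) U i.
have clFE b : closure (F b) `<=` F b `|` [set p].
  by apply: closure_shrinking_union => // n; exact: point_closed.
have FDp b : closure (F b) `\ p `<=` F b by move=> x [/clFE[]].
have clF b : closure (closure (F b) `\ p) p.
  move=> N /Up/(near_infty_odd b)[i ib UN].
  exists (u (phi i)); split; last exact: UN.
  by split; [apply: subset_closure; exists i|exact: up].
exists (closure (F true)), (closure (F false)).
split; [exact: closed_closure..|apply/seteqP; split=> [x|_ -> //]].
move=> [/(closureS (FDp true))/clFE[[i /= it ->]|//]].
move=> /(closureS (FDp false))/clFE[[j /= jf uij]|//].
have [ij|ji|ij] := ltngtP i j; exfalso.
- exact: (phiP _ _ ij).
- by apply: (phiP _ _ ji); rewrite uij.
- by move: jf; rewrite -ij it.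
Qed.

End HausdorffSelections.

Theorem theorem1p2 (X : topologicalType)
    (X_infinite : infinite_set [set: X]) (X_hausdorff : hausdorff_space X)
    (p : X) (pTheta : X_Theta X p) :
  (butterfly_point p <-> limit_of_sequence p) /\
  (butterfly_point p -> totally_disconnected_at p -> cut_point p).
Proof.
have [f [fS fC [[T cT T0] /= TE fT]]] := pTheta.
pose g := extend_selection f p.
have gS : set_selection g by exact: extend_selection_selection.
have gC : set_continuous g by exact: extend_selection_continuous.
have gT : g [set: X] = p by rewrite -TE /g extend_selectionE.
split; [split; last exact: limit_butterfly|].
- move=> bp.
  have [|S [K ch]] := @butterfly_escaping_chain X g X_hausdorff gS gC p
      (fun K => open K /\ K p) (fun K => id) _ gT bp.
    move=> x /nesym/(separated_nbhs X_hausdorff)[N [oN Np nNx]].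
    by exists N.
  by apply: escaping_chain_limit ch => // K' [].
- move=> bp [C [Ccl Cp]].
  have [K [[oK _] Kp]||S [K ch]] := @butterfly_escaping_chain X g X_hausdorff
      gS gC p (fun K => clopen K /\ K p) _ _ gT bp.
  + by [].
  + move=> x xp; have : ~ (\bigcap_(K in C) K) x by rewrite Cp.
    move=> /existsNP[K /not_implyP[CK nKx]]; exists K; split.
      split; first exact: Ccl.
      have Kp : (\bigcap_(K in C) K) p by rewrite Cp.
      exact: Kp K CK.
    by have [_ /closure_id <-] := Ccl K CK.
  exact: escaping_chain_cut ch.
Qed.
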